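(* Fix integers $1\le t\le k$ and positive integers $d_1,\dots,d_t$. Let $q$ be a prime power, and independently for each $i\in[t]$ let $f_i$ be uniform on $\mathbb{F}_q[X_1,\dots,X_k]_{\le d_i}$. Then \[\mathbb{P}\big(\dim V(f_1,\dots,f_t)>k-t\big)\le C_t\, q^{-\min(d_1,\dots,d_t)}\] for a constant $C_t=C_t(d_1,\dots,d_t)>0$ independent of $q$ (one may take $C_t$ depending only on $k$ and the $d_i$). In particular, when $t=k$, \[\mathbb{P}\Big(\big|V(f_1,\dots,f_k)\cap\mathbb{F}_q^k\big|>\prod_{i=1}^k d_i\Big)\le C\,q^{-\min(d_1,\dots,d_k)}\] for a constant $C=C(d_1,\dots,d_k)>0$ independent of $q$.
   Context: $\mathbb{F}_q[X_1,\dots,X_k]_{\le d}$ is the set of $k$-variate polynomials over $\mathbb{F}_q$ of total degree at most $d$, sampled uniformly by choosing all coefficients independently and uniformly. For polynomials $f_1,\dots,f_t$, $V(f_1,\dots,f_t)=\{x\in\overline{\mathbb{F}}_q^{\,k}: f_1(x)=\cdots=f_t(x)=0\}$ is the affine variety over the algebraic closure $\overline{\mathbb{F}}_q$, and $\dim$ is its (Krull) dimension. *)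

(* Defs.v *)
From HB Require Import structures.
From mathcomp Require Import all_boot all_order all_algebra all_field.
From mathcomp Require Import mpoly.
From Stdlib Require Import ClassicalEpsilon.
Set Implicit Arguments. Unset Strict Implicit. Unset Printing Implicit Defensive.
Import Order.TTheory GRing.Theory Num.Theory.
Local Open Scope ring_scope.

Definition decP (P : Prop) : bool :=
  if excluded_middle_informative P then true else false.

Section Geometry.
Variables (L : closedFieldType) (n : nat).

Definition aset := ('I_n -> L) -> Prop.

Definition zariski_closed (S : aset) : Prop :=
  exists P : {mpoly L[n]} -> Prop,
    forall x, S x <-> (forall p, P p -> p.@[x] = 0).

Definition irreducible_closed (S : aset) : Prop :=
  [/\ zariski_closed S, exists x, S x &
      forall A B : aset, zariski_closed A -> zariski_closed B ->
        (forall x, S x -> A x \/ B x) ->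
        (forall x, S x -> A x) \/ (forall x, S x -> B x)].

Definition dim_gt (V : aset) (m : nat) : Prop :=
  exists Z : nat -> aset,
    [/\ forall i, i <= m.+1 -> irreducible_closed (Z i),
        forall i x, i <= m.+1 -> Z i x -> V x &
        forall i, i <= m ->
          (forall x, Z i x -> Z i.+1 x) /\ (exists x, Z i.+1 x /\ ~ Z i x)]%N.
End Geometry.

Definition variety (F : fieldType) (L : closedFieldType) (iota : {rmorphism F -> L})
  (k t : nat) (f : 'I_t -> {mpoly F[k]}) : aset L k :=
  fun x => forall i, (map_mpoly iota (f i)).@[x] = 0.

(* L is algebraic over (the image of) F: together with closedness,
   L is an algebraic closure of F. *)
Definition algebraic_over (F : fieldType) (L : fieldType) (iota : {rmorphism F -> L}) :=
  forall x : L, exists p : {poly F}, p != 0 /\ root (map_poly iota p) x.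

(* A polynomial of total degree <= d is determined by its coefficient vector
   indexed by the monomials of degree < d.+1; uniform polynomial = uniform
   coefficient vector. *)
Definition poly_of (F : fieldType) (k d : nat) (c : {ffun 'X_{1..k < d.+1} -> F})
  : {mpoly F[k]} := \sum_(m : 'X_{1..k < d.+1}) c m *: 'X_[bmnm m].

Definition sample (F : finFieldType) (k t : nat) (d : 'I_t -> nat) :=
  {dffun forall i : 'I_t, {ffun 'X_{1..k < (d i).+1} -> F}}.

Definition polys (F : finFieldType) (k t : nat) (d : 'I_t -> nat)
  (w : sample F k d) : 'I_t -> {mpoly F[k]} := fun i => poly_of (w i).

Definition prob (T : finType) (E : T -> Prop) : rat :=
  (#|[set w : T | decP (E w)]|)%:R / (#|T|)%:R.

(* min(d_1,...,d_t) (for t >= 1) *)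
Definition dmax (t : nat) (d : 'I_t -> nat) : nat := \big[maxn/0%N]_(i < t) d i.
Definition dmin (t : nat) (d : 'I_t -> nat) : nat :=
  \big[minn/(dmax d)]_(i < t) d i.

Definition nb_rat_points (F : finFieldType) (k t : nat) (f : 'I_t -> {mpoly F[k]}) : nat :=
  #|[set x : {ffun 'I_k -> F} | [forall i, (f i).@[x] == 0]]|.

(* Main.v *)
(** Say that (f_1, ..., f_i) is good when, for every set J of k - i + 1
    coordinates, the ideal it generates contains a nonzero polynomial in the variables x_J
    of bounded degree; this holds vacuously for i = 0.  If it holds for i, the leading
    monomials of these polynomials show that the ideal has only O(N^(k-i)) standard
    monomials of degree at most N.  Hence, for #|J| = k - i, the powers 1, g, ..., g^C of any
    polynomial g satisfy a nontrivial relation chi(g) = 0 modulo the ideal, with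
    coefficients in F[x_J].  Writing f_(i+1) = g + psi(x_j) with j in J and psi uniform of
    degree at most d_(i+1), the polynomial chi(-psi) lies in the ideal extended by
    f_(i+1), and it is nonzero for all but C of the q^(d_(i+1)+1) choices of psi.  A union
    bound over i and J gives goodness of (f_1, ..., f_t) with the required probability.

    Goodness bounds the dimension: a chain of irreducible closed sets of length r yields r
    algebraically independent functions on V, against the count of standard monomials.

    For t = k goodness puts a univariate polynomial in each variable into the ideal, and
    Bezout's bound follows by counting: with b_s interpolating at the rational zeros s,
    the products f^a b_s are linearly independent, because a relation would produce at
    some zero s a congruence expressing f^a0 through higher monomials f^a, and then the
    ring modulo the N-th power of the maximal ideal at s would have dimension
    O(N^(k-1)). *)
Require Import Defs.
From HB Require Import structures.
From mathcomp Require Import all_boot all_order all_algebra all_field.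
From mathcomp Require Import mpoly ring zify.
From Stdlib Require Import Classical ClassicalEpsilon.
Set Implicit Arguments. Unset Strict Implicit. Unset Printing Implicit Defensive.
Import Order.TTheory GRing.Theory Num.Theory.
Local Open Scope ring_scope.

(** * Linear relations and standard monomials *)

Lemma card_bigcup_le (T I : finType) (P : pred I) (A : I -> {set T}) :
  (#|\bigcup_(i | P i) A i| <= \sum_(i | P i) #|A i|)%N.
Proof.
elim/big_rec2: _ => [|i n B _ leB]; first by rewrite cards0.
by apply: leq_trans (leq_card_setU _ _) _; rewrite leq_add2l.
Qed.

Lemma card_ord_lt n a : (#|[pred x : 'I_n | (x < a)%N]| <= a)%N.
Proof.
case: a => [|a]; first by rewrite eq_card0.
case: n => [|n]; first by rewrite eq_card0 // => -[].
rewrite -(card_in_imset (f := fun x : 'I_n.+1 => inord x : 'I_a.+1)).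
  by apply: leq_trans (max_card _) _; rewrite card_ord.
move=> x y; rewrite !inE => ltx lty /(congr1 val) /=.
by rewrite !inordK // => xy; apply/val_inj.
Qed.

Section LinearDependence.
Variable F : fieldType.

(** A matrix with more rows than columns has a nonzero left kernel. *)
Lemma exists_left_kernel (T U : finType) (A : {set T}) (B : {set U}) (M : T -> U -> F) :
  (#|B| < #|A|)%N ->
  exists2 c : T -> F, (exists2 a, a \in A & c a != 0) &
    forall b, b \in B -> \sum_(a in A) c a * M a b = 0.
Proof.
move=> ltBA; pose W := \matrix_(i < #|A|, j < #|B|) M (enum_val i) (enum_val j).
pose v := nz_row (kermx W).
have vW0 : v *m W = 0 by apply/sub_kermxP; exact: nz_row_sub.
have v_neq0 : v != 0.
  rewrite nz_row_eq0 -mxrank_eq0 mxrank_ker subn_eq0 -ltnNge.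
  exact: leq_ltn_trans (rank_leq_col _) ltBA.
(* At most one [i] enumerates [a], so [c] extends [v] by zero outside [A]. *)
pose c a := \sum_(i | enum_val i == a) v 0 i.
have cE i : c (enum_val i) = v 0 i.
  by rewrite /c (big_pred1 i) // => j; rewrite (inj_eq enum_val_inj).
exists c.
  have /rV0Pn [i vi] := v_neq0.
  by exists (enum_val i); [exact: enum_valP | rewrite cE].
move=> b bB; rewrite big_enum_val.
have /rowP/(_ (enum_rank_in bB b)) := vW0; rewrite !mxE => vWb.
rewrite -[RHS]vWb; apply: eq_bigr => i _; rewrite cE mxE enum_rankK_in //.
Qed.

Definition subspace (V : lmodType F) (I : V -> Prop) :=
  [/\ I 0, forall p q, I p -> I q -> I (p + q) & forall c p, I p -> I (c *: p)].

Lemma subspace_sum (V : lmodType F) (I : V -> Prop) (T : Type) (r : seq T)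
    (P : pred T) (f : T -> V) :
  subspace I -> (forall i, P i -> I (f i)) -> I (\sum_(i <- r | P i) f i).
Proof. by case=> I0 ID _ If; elim/big_ind: _. Qed.

Section Span.
Variables (V : lmodType F) (I : V -> Prop) (U : finType) (B : {set U}) (e : U -> V).
Hypothesis subI : subspace I.

(** Stands for a span in the quotient of [V] by [I], without forming the quotient. *)
Definition in_span (v : V) := exists c : U -> F, I (v - \sum_(b in B) c b *: e b).

Lemma in_span_sub v : I v -> in_span v.
Proof.
by exists (fun=> 0); rewrite big1 ?subr0 // => b _; rewrite scale0r.
Qed.

Lemma in_span0 : in_span 0.
Proof. by apply: in_span_sub; case: subI. Qed.

Lemma in_spanD v w : in_span v -> in_span w -> in_span (v + w).
Proof.
move=> [c Iv] [c' Iw]; exists (fun b => c b + c' b); have [_ ID _] := subI.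
under eq_bigr do rewrite scalerDl.
by rewrite big_split /= opprD addrACA; exact: ID.
Qed.

Lemma in_spanZ x v : in_span v -> in_span (x *: v).
Proof.
move=> [c Iv]; exists (fun b => x * c b); have [_ _ IZ] := subI.
under eq_bigr do rewrite -scalerA.
by rewrite -scaler_sumr -scalerBr; exact: IZ.
Qed.

Lemma in_span_congr v w : I (v - w) -> in_span w -> in_span v.
Proof. by move=> Ivw sw; rewrite -[v](subrK w); apply: in_spanD => //; exact: in_span_sub. Qed.

Lemma in_span_sum (T : Type) (r : seq T) (P : pred T) (v : T -> V) :
  (forall i, P i -> in_span (v i)) -> in_span (\sum_(i <- r | P i) v i).
Proof. by move=> sv; elim/big_ind: _ => //; [exact: in_span0 | exact: in_spanD]. Qed.

Lemma mem_in_span b : b \in B -> in_span (e b).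
Proof.
move=> bB; exists (fun b' => (b' == b)%:R).
rewrite (bigD1 b) //= eqxx scale1r big1 => [|b' /andP[_ /negPf->]]; last exact: scale0r.
by rewrite addr0 subrr; case: subI.
Qed.

(** Expressing each [g a] through the fewer [e b] modulo [I] gives a coefficient matrix; a left
    kernel vector cancels every [e b]. *)
Lemma exists_relation (T : finType) (A : {set T}) (g : T -> V) :
  (forall a, a \in A -> in_span (g a)) -> (#|B| < #|A|)%N ->
  exists2 c : T -> F, (exists2 a, a \in A & c a != 0) & I (\sum_(a in A) c a *: g a).
Proof.
move=> spanI ltBA.
have [M MP] : exists M : T -> U -> F,
    forall a, a \in A -> I (g a - \sum_(b in B) M a b *: e b).
  apply: (fin_all_exists (P := fun a c => a \in A -> I (g a - \sum_(b in B) c b *: e b))).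
  move=> a; case: (boolP (a \in A)) => [aA | _]; last by exists (fun=> 0).
  by have [c cP] := spanI a aA; exists c.
have [c c_neq0 cM] := exists_left_kernel M ltBA.
exists c => //.
have -> : \sum_(a in A) c a *: g a =
          \sum_(a in A) c a *: (g a - \sum_(b in B) M a b *: e b).
  under [RHS]eq_bigr do rewrite scalerBr scaler_sumr.
  rewrite sumrB [X in _ - X]exchange_big /= [X in _ - X]big1 ?subr0 // => b bB.
  under eq_bigr do rewrite scalerA.
  by rewrite -scaler_suml cM // scale0r.
have [_ _ IZ] := subI.
by apply: subspace_sum => // a aA; apply: IZ; exact: MP.
Qed.

End Span.

End LinearDependence.

(** * Polynomials in a subset of the variables, and division by leading monomials *)

Section Supports.
Variables (k : nat) (F : fieldType).
Implicit Types (p q : {mpoly F[k]}) (J : {set 'I_k}).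

Definition ideal (I : {mpoly F[k]} -> Prop) :=
  [/\ I 0, forall p q, I p -> I q -> I (p + q) & forall a p, I p -> I (a * p)].

Lemma ideal_subspace (I : {mpoly F[k]} -> Prop) : ideal I -> subspace I.
Proof. by case=> I0 ID IM; split=> // c p Ip; rewrite -mul_mpolyC; exact: IM. Qed.

(** Degree at most [n] in [F[x_J]], read off the support so that all polynomials stay in one
    ring. *)
Definition supp_in J (n : nat) p :=
  forall m, m \in msupp p -> (mdeg m <= n)%N /\ forall i, i \notin J -> m i = 0%N.

Lemma supp_in0 J n : supp_in J n 0.
Proof. by move=> m; rewrite msupp0. Qed.

Lemma supp_inW J n n' p : (n <= n')%N -> supp_in J n p -> supp_in J n' p.
Proof. by move=> le_n pJ m /pJ[le_m mJ]; split=> //; exact: leq_trans le_n. Qed.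

Lemma supp_inD J n p q : supp_in J n p -> supp_in J n q -> supp_in J n (p + q).
Proof. by move=> pJ qJ m /msuppD_le; rewrite mem_cat => /orP[/pJ | /qJ]. Qed.

Lemma supp_inZ J n c p : supp_in J n p -> supp_in J n (c *: p).
Proof. by move=> pJ m /msuppZ_le /pJ. Qed.

Lemma supp_in_sum J n (T : Type) (r : seq T) (P : pred T) (f : T -> {mpoly F[k]}) :
  (forall i, P i -> supp_in J n (f i)) -> supp_in J n (\sum_(i <- r | P i) f i).
Proof. by move=> fJ; elim/big_ind: _ => //; [exact: supp_in0 | exact: supp_inD]. Qed.

Lemma supp_inM J n n' p q :
  supp_in J n p -> supp_in J n' q -> supp_in J (n + n') (p * q).
Proof.
move=> pJ qJ m /msuppM_le /allpairsP[[m1 m2] /= [/pJ[le1 m1J] /qJ[le2 m2J] ->]].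
split=> [|i iJ]; first by rewrite mdegD leq_add.
by rewrite mnmDE m1J ?m2J.
Qed.

Lemma supp_inX J (m : 'X_{1..k}) n : (mdeg m <= n)%N ->
  (forall i, i \notin J -> m i = 0%N) -> supp_in J n 'X_[m].
Proof. by move=> le_m mJ m'; rewrite msuppX inE => /eqP ->. Qed.

Lemma supp_in1 J : supp_in J 0 1.
Proof.
by rewrite -mpolyX0; apply: supp_inX => [|i _]; rewrite ?mdeg0 ?mnm0E.
Qed.

Lemma supp_in_exp J n p e : supp_in J n p -> supp_in J (e * n) (p ^+ e).
Proof.
move=> pJ; elim: e => [|e IHe]; first by rewrite expr0 mul0n; exact: supp_in1.
by rewrite exprS mulSn; exact: supp_inM.
Qed.

Lemma supp_in_setT p n : (msize p <= n.+1)%N -> supp_in setT n p.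
Proof.
move=> le_p m mp; split=> [|i]; last by rewrite inE.
by rewrite -ltnS; apply: leq_trans le_p; exact: mmeasure_mnm_lt.
Qed.

Lemma supp_in_widen J J' n p : J \subset J' -> supp_in J n p -> supp_in J' n p.
Proof.
move=> sJ pJ m /pJ[le_m mJ]; split=> // i iJ; apply: mJ.
by apply: contra iJ; exact: (subsetP sJ).
Qed.

Definition mnm_of N (a : {ffun 'I_k -> 'I_N}) : 'X_{1..k} :=
  [multinom (a i : nat) | i < k].

Lemma mnm_of_inj N : injective (@mnm_of N).
Proof.
move=> a b /mnmP ab; apply/ffunP => i; apply/val_inj.
by have := ab i; rewrite !mnmE.
Qed.

Lemma mdeg_mnm_of N (a : {ffun 'I_k -> 'I_N.+1}) : (mdeg (mnm_of a) <= k * N)%N.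
Proof.
rewrite mdegE -[k in (k * _)%N]card_ord -sum_nat_const; apply: leq_sum => i _.
by rewrite mnmE -ltnS.
Qed.

Lemma mnm_ofP N (m : 'X_{1..k}) : (forall i, (m i < N)%N) ->
  {a : {ffun 'I_k -> 'I_N} | mnm_of a = m}.
Proof.
move=> lt_m; exists [ffun i => Ordinal (lt_m i)].
by apply/mnmP => i; rewrite mnmE ffunE.
Qed.

Lemma mnm_le_mdeg (m : 'X_{1..k}) i : (m i <= mdeg m)%N.
Proof. by rewrite mdegE (bigD1 i) //= leq_addr. Qed.

(** One division step: subtracting the monomial multiple of [P] with leading term ['X_[m]] leaves
    the shifted lower terms of [P], all smaller because the order is compatible with addition. *)
Lemma leading_reduction (I : {mpoly F[k]} -> Prop) P (m : 'X_{1..k}) :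
  ideal I -> I P -> P != 0 -> (mlead P <= m)%MM ->
  exists2 s : seq (F * 'X_{1..k}), {in s, forall x, (x.2 < m)%O} &
    I ('X_[m] - \sum_(x <- s) x.1 *: 'X_[x.2]).
Proof.
move=> idI IP P_neq0 le_m; have [_ _ IM] := idI.
have lc_neq0 : mleadc P != 0 by rewrite mleadc_eq0.
exists [seq (- (mleadc P)^-1 * P@_m', (m - mlead P + m')%MM) |
          m' <- rem (mlead P) (msupp P)].
  move=> x /mapP[m' m'P ->] /=; rewrite -[X in (_ < X)%O](submK le_m) ltmc_add2r.
  rewrite mem_rem_uniq ?msupp_uniq // inE in m'P.
  by have /andP[ne /msupp_le_mlead le] := m'P; rewrite lt_neqAle ne.
set s := rem _ _.
have -> : 'X_[m] - \sum_(x <- [seq (- (mleadc P)^-1 * P@_m', (m - mlead P + m')%MM) |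
     m' <- s]) x.1 *: 'X_[x.2] = ((mleadc P)^-1 *: 'X_[m - mlead P]) * P.
  have PE : P = mleadc P *: 'X_[mlead P] + \sum_(m' <- s) P@_m' *: 'X_[m'].
    by rewrite [LHS]mpolyE (perm_big _ (perm_to_rem (mlead_supp P_neq0))) big_cons.
  rewrite big_map /= [X in _ = _ * X]PE.
  rewrite mulrDr -scalerAr -scalerAl scalerA divff // scale1r -mpolyXD submK //.
  congr (_ + _); rewrite -sumrN mulr_sumr; apply: eq_bigr => m' _.
  by rewrite -scalerAr -scalerAl -mpolyXD scalerA -scaleNr mulNr opprK mulrC.
exact: IM.
Qed.

(** * Counting monomials modulo an ideal with a relation in every [r + 1] variables *)

Section Standard.
Variables (I : {mpoly F[k]} -> Prop) (r D : nat).
Hypothesis idI : ideal I.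
Hypothesis relI : forall J, #|J| = r.+1 ->
  exists P : {mpoly F[k]}, [/\ P != 0, supp_in J D P & I P].

Let subI := ideal_subspace idI.

(** If more than [r] exponents reach [D], the leading monomial of some relation divides the
    monomial; only the exponents kept here can resist reduction. *)
Definition std N : {set {ffun 'I_k -> 'I_N.+1}} :=
  [set a : {ffun 'I_k -> 'I_N.+1} | (#|[set j | D <= a j]| <= r)%N].

Definition span_std N : {mpoly F[k]} -> Prop :=
  in_span I (std N) (fun a => 'X_[mnm_of a]).

(** Well-founded induction on the monomial order: reduction yields smaller monomials, and since the
    order refines the degree, the bound [N] persists. *)
Lemma span_std_mnm N (m : 'X_{1..k}) : (mdeg m <= N)%N -> span_std N 'X_[m].
Proof.
elim/(@ltmwf k): m => m IHm le_m.
have [le_r | lt_r] := leqP #|[set j | D <= m j]%N| r.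
  have lt_m i : (m i < N.+1)%N by rewrite ltnS; exact: leq_trans (mnm_le_mdeg _ _) le_m.
  have [a aE] := mnm_ofP lt_m; rewrite -aE; apply: (mem_in_span _ subI).
  rewrite inE; apply: leq_trans le_r; rewrite subset_leq_card //.
  by apply/subsetP => j; rewrite !inE -aE mnmE.
have [J sJ cJ] : exists2 J : {set 'I_k}, J \subset [set j | D <= m j]%N & #|J| = r.+1.
  have: (0 < #|[set J : {set 'I_k} | (J \subset [set j | D <= m j]%N) & (#|J| == r.+1)]|)%N.
    by rewrite cards_draws bin_gt0.
  by case/card_gt0P=> J; rewrite inE => /andP[sJ /eqP cJ]; exists J.
have [P [P_neq0 PJ IP]] := relI cJ.
have [s s_lt Is] : exists2 s : seq (F * 'X_{1..k}), {in s, forall x, (x.2 < m)%O} &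
  I ('X_[m] - \sum_(x <- s) x.1 *: 'X_[x.2]).
  apply: (leading_reduction idI IP P_neq0); apply/mnm_lepP => i.
  have [le_D P_J] := PJ _ (mlead_supp P_neq0).
  have [iJ | /P_J -> //] := boolP (i \in J).
  have := subsetP sJ i iJ; rewrite inE => leD.
  by apply: leq_trans (mnm_le_mdeg _ i) (leq_trans le_D leD).
apply: (in_span_congr subI Is); rewrite big_seq; apply: (in_span_sum subI) => x /s_lt lt_x.
apply: (in_spanZ subI); apply: IHm => //.
by apply: leq_trans le_m; apply: lemc_mdeg; exact: ltW.
Qed.

Lemma span_stdP N p : (msize p <= N.+1)%N -> span_std N p.
Proof.
move=> le_p; rewrite (mpolyE p) big_seq; apply: (in_span_sum subI) => m mp.
apply: (in_spanZ subI); apply: span_std_mnm.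
by rewrite -ltnS; apply: leq_trans le_p; exact: mmeasure_mnm_lt.
Qed.

(** Choose the set of large coordinates in at most [2 ^ k] ways; at most [r] exponents then have
    [N.+1] values, and the others at most [D]. *)
Lemma card_std N : (0 < D)%N -> (#|std N| <= 2 ^ k * D ^ k * N.+1 ^ r)%N.
Proof.
move=> D_gt0.
pose R (J : {set 'I_k}) (i : 'I_k) : pred 'I_N.+1 :=
  [pred x : 'I_N.+1 | (i \in J) || (x < D)%N].
have sub : std N \subset
    \bigcup_(J : {set 'I_k} | (#|J| <= r)%N) [set a in family (R J)].
  apply/subsetP => a; rewrite inE => le_r; apply/bigcupP.
  exists [set j | D <= a j]%N => //; rewrite inE; apply/familyP => i.
  by rewrite !inE; case: leqP.
have le1 J : (#|J| <= r)%N -> (#|[set a in family (R J)]| <= D ^ k * N.+1 ^ r)%N.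
  move=> le_J; rewrite cardsE card_family foldrE big_map big_enum /=.
  apply: (@leq_trans (\prod_(i < k) (D * (if i \in J then N.+1 else 1)))%N).
    apply: leq_prod => i _; rewrite /R; case: ifP => iJ.
      apply: leq_trans (leq_pmull _ D_gt0).
      by apply: leq_trans (max_card _) _; rewrite card_ord.
    rewrite muln1; apply: leq_trans (card_ord_lt N.+1 D); apply: subset_leq_card.
    by apply/subsetP => x; rewrite !inE.
  rewrite big_split /= prod_nat_const card_ord leq_mul2l -big_mkcond /= prod_nat_const.
  by rewrite leq_pexp2l ?orbT.
apply: leq_trans (subset_leq_card sub) _.
apply: leq_trans (card_bigcup_le _ _) _.
apply: (@leq_trans (\sum_(J : {set 'I_k} | (#|J| <= r)%N) (D ^ k * N.+1 ^ r))%N).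
  exact: leq_sum.
rewrite sum_nat_const -mulnA leq_mul2r; apply/orP; right.
by apply: leq_trans (max_card _) _; rewrite -cardsT -powersetT card_powerset cardsT card_ord.
Qed.

Lemma exists_relation_mod (T : finType) (A : {set T}) N (g : T -> {mpoly F[k]}) :
  (0 < D)%N ->
  {in A, forall a, (msize (g a) <= N.+1)%N} ->
  (2 ^ k * D ^ k * N.+1 ^ r < #|A|)%N ->
  exists2 c : T -> F, (exists2 a, a \in A & c a != 0) & I (\sum_(a in A) c a *: g a).
Proof.
move=> D_gt0 le_g lt_A.
apply: (exists_relation (e := fun a => 'X_[mnm_of a]) (B := std N) subI).
- by move=> a /le_g; exact: span_stdP.
exact: leq_ltn_trans (card_std _ D_gt0) lt_A.
Qed.

End Standard.
End Supports.

(** * Elimination of one equation *)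

Lemma classical_decP (P : Prop) : reflect P (Defs.decP P).
Proof. by rewrite /Defs.decP; case: excluded_middle_informative => ?; constructor. Qed.

Lemma dvd_horner_sub (R : comNzRingType) (p : {poly R}) (x y : R) :
  exists q, p.[x] - p.[y] = q * (x - y).
Proof.
have /factor_theorem[q qE] : root (p - p.[y]%:P) y.
  by rewrite rootE hornerD hornerN hornerC subrr.
exists q.[x]; have := congr1 (fun r => r.[x]) qE.
by rewrite hornerM !hornerD !hornerN !hornerC hornerX.
Qed.

Section Elimination.
Variables (k : nat) (F : fieldType) (I : {mpoly F[k]} -> Prop) (r D d : nat).
Hypothesis idI : ideal I.
Hypothesis relI : forall J : {set 'I_k}, #|J| = r.+1 ->
  exists P : {mpoly F[k]}, [/\ P != 0, supp_in J D P & I P].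
Hypothesis D_gt0 : (0 < D)%N.

Lemma msize_supp_in (J : {set 'I_k}) n (p : {mpoly F[k]}) :
  supp_in J n p -> (msize p <= n.+1)%N.
Proof. by move=> pJ; rewrite mmeasureE; apply/bigmax_leqP_seq => m /pJ[]. Qed.

(** Call this value [C]. It is chosen so that, for [r <= k], the bound
    [2 ^ k * D ^ k * ((k + 1) * (M + 1)) ^ r] on reduced monomials is at most [C * (M + 1) ^ r]. *)
Definition elim_card : nat := 2 ^ k * D ^ k * k.+1 ^ k.

(** The products of a monomial in [x_J] with exponents at most [M] and a power [f ^+ e], [e <= C],
    number [(M + 1) ^ r * (C + 1)] and have degree at most [k * M + M]. This exceeds the count of
    reduced monomials, and a relation sorted by powers of [f] is [chi]. *)
Lemma exists_resolvent (J : {set 'I_k}) (f : {mpoly F[k]}) :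
  #|J| = r -> (msize f <= d.+1)%N ->
  exists chi : {poly {mpoly F[k]}},
    [/\ chi != 0, (size chi <= elim_card.+1)%N, I chi.[f] &
        forall e, supp_in J (k * (elim_card * d)) chi`_e].
Proof.
set C := elim_card; set M := (C * d)%N => cJ le_f.
pose Box : {set {ffun 'I_k -> 'I_M.+1}} := [set a in pffun_on ord0 (mem J) predT].
have cBox : #|Box| = (M.+1 ^ r)%N by rewrite cardsE card_pffun_on cJ card_ord.
have BoxJ (a : {ffun 'I_k -> 'I_M.+1}) : a \in Box ->
    supp_in J (k * M) ('X_[mnm_of a] : {mpoly F[k]}).
  rewrite inE => /pffun_onP[aJ _]; apply: supp_inX => [|i iJ]; first exact: mdeg_mnm_of.
  rewrite mnmE; apply/eqP; apply: contraNT iJ => ai.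
  by have /subsetP/(_ i) := aJ; apply; rewrite supportE -val_eqE.
pose A : {set {ffun 'I_k -> 'I_M.+1} * 'I_C.+1} := setX Box setT.
have le_r : (r <= k)%N by rewrite -cJ -[k in leqRHS]card_ord max_card.
have [c [a0 a0A c_neq0] Ic] : exists2 c, (exists2 x, x \in A & c x != 0) &
    I (\sum_(x in A) c x *: ('X_[mnm_of x.1] * f ^+ x.2)).
  apply: (exists_relation_mod (N := k * M + M) idI relI D_gt0).
    move=> [a e] /=; rewrite inE /= => /andP[aBox _].
    apply: (@msize_supp_in setT); apply: (supp_inW (n := k * M + e * d)).
      by rewrite leq_add2l leq_mul2r -ltnS ltn_ord orbT.
    apply: supp_inM; first exact: supp_in_widen (subsetT _) (BoxJ _ aBox).
    by apply: supp_in_exp; exact: supp_in_setT.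
  rewrite cardsX cBox cardsT card_ord.
  have le_N : ((k * M + M).+1 <= k.+1 * M.+1)%N by rewrite mulnSr mulSn; lia.
  apply: (@leq_ltn_trans (2 ^ k * D ^ k * (k.+1 ^ k * M.+1 ^ r)))%N.
    rewrite leq_mul2l; apply/orP; right.
    apply: leq_trans (leq_mul (leq_pexp2l (ltn0Sn k) le_r) (leqnn _)).
    by rewrite -expnMn; case: (r) => // r'; rewrite leq_exp2r.
  by rewrite mulnA mulnC ltn_pmul2l ?expn_gt0.
exists (\sum_(x in A) (c x *: 'X_[mnm_of x.1]) *: 'X^(x.2)).
have coefE e : (\sum_(x in A) (c x *: 'X_[mnm_of x.1]) *: 'X^(x.2))`_e =
    \sum_(x in A) ((e == x.2)%:R * c x) *: 'X_[mnm_of x.1] :> {mpoly F[k]}.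
  rewrite coef_sum; apply: eq_bigr => x _; rewrite coefZ coefXn.
  by case: eqP => _; rewrite ?mulr1 ?mul1r // mulr0 mul0r scale0r.
split.
(* In the coefficient of [chi] at [a0.2], the monomial [mnm_of a0.1] has coefficient [c a0], which
   is nonzero. *)
- apply: contraNneq c_neq0 => chi0; have := coefE a0.2; rewrite chi0 coef0.
  move/(congr1 (mcoeff (mnm_of a0.1))); rewrite mcoeff0 linear_sum /= (bigD1 a0) //=.
  rewrite mcoeffZ mcoeffX !eqxx mul1r mulr1 big1 ?addr0 => [<- //|x /andP[_ ne_x]].
  rewrite mcoeffZ mcoeffX (inj_eq (@mnm_of_inj _ _)).
  case: eqP => [e2|_]; last by rewrite !mul0r.
  case: eqP => [e1|_]; last by rewrite mulr0.
  move/eqP: ne_x; case; move: e1 e2; case: (x) (a0) => [x1 x2] [y1 y2] /= -> e2.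
  by congr (_, _); apply/val_inj.
- apply: leq_trans (size_sum _ _ _) _; apply/bigmax_leqP => x _.
  apply: leq_trans (size_scale_leq _ _) _.
  by rewrite size_polyXn ltn_ord.
- rewrite horner_sum; congr I: Ic; apply: eq_bigr => x _.
  by rewrite hornerZ hornerXn scalerAl.
move=> e; rewrite coefE; apply: supp_in_sum => x; rewrite inE => /andP[xBox _].
by apply: supp_inZ; exact: BoxJ.
Qed.

(** The first summand bounds the coefficients of the resolvent, the second the powers of the shift
    substituted into it. *)
Definition elim_deg := (k * (elim_card * d) + elim_card * d)%N.

Definition elim_in (J : {set 'I_k}) (f : {mpoly F[k]}) :=
  exists P : {mpoly F[k]}, [/\ P != 0, supp_in J elim_deg P & exists h, I (P - h * f)].

(* With the resolvent chi of f, the polynomial chi(-psi) is congruent to chi(f)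
   modulo f + psi, so that a shift psi with chi(-psi) <> 0 is good. *)
Lemma card_bad_shifts (J : {set 'I_k}) (f : {mpoly F[k]})
    (T : finType) (psi : T -> {mpoly F[k]}) :
  #|J| = r -> (msize f <= d.+1)%N -> injective psi ->
  (forall x, supp_in J d (psi x)) ->
  (#|[set x | Defs.decP (~ elim_in J (f + psi x)%R)]| <= elim_card)%N.
Proof.
move=> cJ le_f psi_inj psiJ.
have [chi [chi_neq0 size_chi Ichi chiJ]] := exists_resolvent cJ le_f.
set Bad := [set x | _].
(* Bad shifts give distinct roots [- psi x] of [chi], whose number over an integral domain is less
   than its size. *)
suff: (size [seq - psi x | x <- enum Bad] < size chi)%N.
  by rewrite size_map -cardE => /leq_trans/(_ size_chi).
apply: max_poly_roots => //; last first.
  by rewrite map_inj_uniq ?enum_uniq // => x y /oppr_inj/psi_inj.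
apply/allP => _ /mapP[x xBad ->].
move: xBad; rewrite mem_enum inE => /classical_decP bad_x.
apply/rootP; apply: NNPP => /eqP chi_psi_neq0; case: bad_x; exists chi.[- psi x].
split; first exact: chi_psi_neq0.
  rewrite horner_coef; apply: supp_in_sum => e _.
  apply: (@supp_inW _ _ _ (k * (elim_card * d) + e * d)).
    rewrite leq_add2l leq_mul2r -ltnS; apply/orP; right.
    exact: leq_trans (ltn_ord e) size_chi.
  apply: supp_inM => //; apply: supp_in_exp.
  by rewrite -scaleN1r; exact: supp_inZ.
have [q qE] := dvd_horner_sub chi f (- psi x).
exists (- q); congr I: Ichi; rewrite opprK in qE.
by rewrite mulNr opprK -qE addrC subrK.
Qed.

End Elimination.

(** * Counting bad samples *)

(** Double counting of the pairs with [shift psi w \in Bad]: each [shift psi] is a bijection, so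
    every [psi] contributes [#|Bad|], while every [w] contributes at most [C]. *)
Lemma card_shift_bound (T Psi : finType) (shift : Psi -> T -> T) (Bad : {set T}) (C : nat) :
  (forall psi, injective (shift psi)) ->
  (forall w, #|[set psi | shift psi w \in Bad]| <= C)%N ->
  (#|Bad| * #|Psi| <= C * #|T|)%N.
Proof.
move=> shift_inj leC; rewrite mulnC -sum_nat_const [leqRHS]mulnC -sum_nat_const.
have -> : (\sum_(psi : Psi) #|Bad| = \sum_(psi : Psi) \sum_(w : T) (shift psi w \in Bad))%N.
  apply: eq_bigr => psi _; rewrite -(on_card_preimset (f := shift psi)).
    by rewrite -sum1_card big_mkcond; apply: eq_bigr => w _; rewrite inE; case: ifP.
  by apply: onW_bij; exact: injF_bij.
rewrite exchange_big /=; apply: leq_sum => w _; apply: leq_trans (leC w).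
by rewrite -sum1_card [leqRHS]big_mkcond; apply: leq_sum => psi _; rewrite inE; case: ifP.
Qed.

(** * Ideals of initial segments, and goodness *)

Section Ideals.
Variables (k t : nat) (F : fieldType).

Definition in_ideal (i : nat) (f : 'I_t -> {mpoly F[k]}) (g : {mpoly F[k]}) :=
  exists h : 'I_t -> {mpoly F[k]}, g = \sum_(l < t | (l < i)%N) h l * f l.

Lemma ideal_in_ideal i f : ideal (in_ideal i f).
Proof.
split; first by exists (fun=> 0); rewrite big1 // => l _; rewrite mul0r.
  move=> _ _ [g ->] [h ->]; exists (fun l => g l + h l).
  by rewrite -big_split; apply: eq_bigr => l _; rewrite mulrDl.
move=> a _ [h ->]; exists (fun l => a * h l).
by rewrite mulr_sumr; apply: eq_bigr => l _; rewrite mulrA.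
Qed.

Lemma eq_in_ideal i f f' g :
  (forall l : 'I_t, (l < i)%N -> f l = f' l) -> in_ideal i f g -> in_ideal i f' g.
Proof.
by move=> eq_f [h ->]; exists h; apply: eq_bigr => l lt_l; rewrite eq_f.
Qed.

Lemma in_idealS (i : 'I_t) f g h :
  in_ideal i f (g - h * f i) -> in_ideal i.+1 f g.
Proof.
case=> h' /eqP; rewrite subr_eq => /eqP ->.
exists (fun l => if l == i then h else h' l).
rewrite [RHS](bigD1 i) //= eqxx addrC; congr (_ + _).
apply: eq_big => [l|l lt_l]; last first.
  by case: eqP lt_l => [->|//]; rewrite ltnn.
by rewrite ltnS [RHS]andbC -ltn_neqAle.
Qed.

Definition relation_in i D (f : 'I_t -> {mpoly F[k]}) (J : {set 'I_k}) :=
  exists P : {mpoly F[k]}, [/\ P != 0, supp_in J D P & in_ideal i f P].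

(* Over an algebraic closure this says that V(f_0, ..., f_(i-1)) has dimension at most
   k - i, witnessed by relations of degree at most D. *)
Definition good i D (f : 'I_t -> {mpoly F[k]}) :=
  forall J : {set 'I_k}, #|J| = (k - i).+1 -> relation_in i D f J.

End Ideals.

(** The degree bound after [i] eliminations. The successor keeps it positive, as the monomial count
    requires; at stage 0 goodness is vacuous. *)
Fixpoint good_deg (k d i : nat) : nat :=
  if i is i'.+1 then (elim_deg k (good_deg k d i') d).+1 else 1.

Lemma good_deg_gt0 k d i : (0 < good_deg k d i)%N.
Proof. by case: i. Qed.

(** * Random univariate shifts and the union bound *)

Section Counting.
Variables (F : finFieldType) (k t : nat) (d : 'I_t -> nat).
Hypothesis le_tk : (t <= k)%N.
Notation D := (good_deg k (dmax d)).
Implicit Types (w : sample F k d).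

Lemma poly_ofD n (c c' : {ffun 'X_{1..k < n.+1} -> F}) :
  poly_of (c + c') = poly_of c + poly_of c'.
Proof.
by rewrite /poly_of -big_split; apply: eq_bigr => m _; rewrite ffunE scalerDl.
Qed.

Lemma mcoeff_poly_of n (c : {ffun 'X_{1..k < n.+1} -> F}) (m : 'X_{1..k < n.+1}) :
  (poly_of c)@_m = c m.
Proof.
rewrite /poly_of linear_sum /= (bigD1 m) //= mcoeffZ mcoeffX eqxx mulr1.
rewrite big1 ?addr0 // => m' ne; rewrite mcoeffZ mcoeffX -bmeqP.
by rewrite (negPf ne) mulr0.
Qed.

Lemma supp_in_poly_of n (c : {ffun 'X_{1..k < n.+1} -> F}) (J : {set 'I_k}) :
  (forall m : 'X_{1..k < n.+1}, c m != 0 -> forall i, i \notin J -> m i = 0%N) ->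
  supp_in J n (poly_of c).
Proof.
move=> cJ; apply: supp_in_sum => m _.
have [->|cm] := eqVneq (c m) 0; first by rewrite scale0r; exact: supp_in0.
apply: supp_inZ; apply: supp_inX; last exact: cJ.
by rewrite -ltnS bmdeg.
Qed.

Lemma le_dmax i : (d i <= dmax d)%N.
Proof. exact: leq_bigmax. Qed.

Lemma dmin_le i : (dmin d <= d i)%N.
Proof.
rewrite /dmin; move: (mem_index_enum i); elim: (index_enum _) => // l s IHs.
rewrite inE big_cons => /orP[/eqP -> | /IHs le_s]; first exact: geq_minl.
exact: leq_trans (geq_minr _ _) le_s.
Qed.

Lemma msize_polys w i : (msize (polys w i) <= (dmax d).+1)%N.
Proof.
apply: leq_trans (_ : (d i).+1 <= _)%N; last by rewrite ltnS le_dmax.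
by apply: (@msize_supp_in _ _ setT); apply: supp_in_poly_of => m _ l; rewrite inE.
Qed.

Section Shift.
Variables (i : 'I_t) (j : 'I_k).

(** The coefficient vector of a univariate polynomial in [x_j]; the test singles out the pure powers
    of [x_j]. *)
Definition univ n (psi : {ffun 'I_n.+1 -> F}) : {ffun 'X_{1..k < n.+1} -> F} :=
  [ffun m : 'X_{1..k < n.+1} =>
     if (m == U_(j) *+ m j :> 'X_{1..k})%MM then psi (inord (m j)) else 0].

Lemma supp_in_univ n (psi : {ffun 'I_n.+1 -> F}) (J : {set 'I_k}) :
  j \in J -> supp_in J n (poly_of (univ psi)).
Proof.
move=> jJ; apply: supp_in_poly_of => m; rewrite ffunE; case: ifP => [/eqP mE _|_ /eqP//].
move=> l lJ; rewrite mE mulmnE mnm1E; case: eqP => // jl.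
by rewrite -jl jJ in lJ.
Qed.

Lemma univ_inj n : injective (fun psi : {ffun 'I_n.+1 -> F} => poly_of (univ psi)).
Proof.
move=> psi psi' eq_psi; apply/ffunP => e.
have lt_e : (mdeg (U_(j) *+ e : 'X_{1..k})%MM < n.+1)%N by rewrite mdegMn mdeg1 mul1n.
have := congr1 (mcoeff (BMultinom lt_e)) eq_psi; rewrite !mcoeff_poly_of !ffunE /=.
by rewrite mulmnE mnm1E eqxx mul1n eqxx inord_val.
Qed.

(** The type of a component depends on [l], so [psi] is reindexed through [inord]; at [l = i] this
    is [psi] itself. *)
Definition shift (psi : {ffun 'I_(d i).+1 -> F}) w : sample F k d :=
  finfun (fun l => w l +
    (if l == i then univ [ffun e : 'I_(d l).+1 => psi (inord e)] else 0)).

Lemma shift_inj psi : injective (shift psi).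
Proof.
move=> w w' /ffunP eq_w; apply/ffunP => l; have := eq_w l.
by rewrite !ffunE => /addIr.
Qed.

Lemma polys_shift psi w l : l != i -> polys (shift psi w) l = polys w l.
Proof. by move=> /negPf ne_l; rewrite /polys ffunE ne_l addr0. Qed.

Lemma polys_shift_eq psi w : polys (shift psi w) i = polys w i + poly_of (univ psi).
Proof.
rewrite /polys ffunE eqxx poly_ofD; congr (_ + poly_of (univ _)).
by apply/ffunP => e; rewrite ffunE inord_val.
Qed.

Definition bad (J : {set 'I_k}) : {set sample F k d} :=
  [set w | Defs.decP (good i (D i) (polys w) /\ ~ relation_in i.+1 (D i.+1) (polys w) J)].

(** Shifting equation [i] by a polynomial in [x_j] keeps the earlier equations, and elimination
    allows at most [elim_card] bad shifts among the [#|F| ^ (d i).+1]. *)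
Lemma card_bad (J : {set 'I_k}) : #|J| = (k - i)%N -> j \in J ->
  (#|bad J| * #|F| ^ (d i).+1 <= elim_card k (D i) * #|{: sample F k d}|)%N.
Proof.
move=> cJ jJ; rewrite -[X in (_ ^ X)%N]card_ord -card_ffun.
apply: (card_shift_bound shift_inj) => w.
(* If some shift of [w] is bad, goodness at stage [i] passes from it to [w], as it involves only the
   unchanged equations. *)
have [-> | [psi0]] := set_0Vmem [set psi | shift psi w \in bad J]; first by rewrite cards0.
rewrite !inE => /classical_decP[good0 _].
have eq_f psi (l : 'I_t) : (l < i)%N -> polys (shift psi w) l = polys w l.
  by move=> lt_l; apply: polys_shift; rewrite neq_ltn lt_l.
have goodw : good i (D i) (polys w).
  move=> J' /good0[P [P_neq0 PJ IP]]; exists P; split=> //.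
  by apply: eq_in_ideal IP => l /eq_f ->.
have := card_bad_shifts (ideal_in_ideal i (polys w)) goodw (good_deg_gt0 _ _ _) cJ
   (msize_polys w i) (@univ_inj _)
   (fun psi => supp_inW (le_dmax i) (@supp_in_univ _ psi _ jJ)).
apply: leq_trans; apply: subset_leq_card; apply/subsetP => psi; rewrite !inE.
move=> /classical_decP[_ nrel]; apply/classical_decP; case=> P [P_neq0 PJ [h IP]].
apply: nrel; exists P; split=> //; first exact: supp_inW (leqnSn _) PJ.
apply: (in_idealS (h := h)); rewrite polys_shift_eq.
by apply: eq_in_ideal IP => l /eq_f ->.
Qed.

End Shift.

(** Stage 0 is good because no set has [k + 1] coordinates, so some step from a good stage [i] must
    lack a relation at [i.+1]. *)
Lemma not_good_bad w : ~ good t (D t) (polys w) ->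
  exists i : 'I_t, exists2 J : {set 'I_k}, #|J| = (k - i)%N & w \in bad i J.
Proof.
move=> ngood; apply: NNPP => nbad; apply: ngood.
suff: forall i, (i <= t)%N -> good i (D i) (polys w) by apply.
elim=> [_ J|i IHi lt_i J cJ].
  by rewrite subn0 => cJ; have := max_card (mem J); rewrite cJ card_ord ltnn.
apply: NNPP => nrel; apply: nbad; exists (Ordinal lt_i), J.
  by rewrite cJ /= subnSK // (leq_trans lt_i).
by rewrite inE; apply/classical_decP; split=> //; apply: IHi; exact: ltnW.
Qed.

Definition not_good_const : nat := \sum_(i < t) 2 ^ k * elim_card k (D i).

Lemma card_not_good :
  (#|[set w : sample F k d | Defs.decP (~ good t (D t) (polys w))]| * #|F| ^ dmin d
    <= not_good_const * #|{: sample F k d}|)%N.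
Proof.
have sub : [set w : sample F k d | Defs.decP (~ good t (D t) (polys w))] \subset
    \bigcup_(i : 'I_t) \bigcup_(J : {set 'I_k} | #|J| == (k - i)%N) bad i J.
  apply/subsetP => w; rewrite inE => /classical_decP /not_good_bad[i [J cJ wbad]].
  by apply/bigcupP; exists i => //; apply/bigcupP; exists J => //; apply/eqP.
apply: leq_trans (leq_mul (subset_leq_card sub) (leqnn _)) _.
apply: leq_trans (leq_mul (card_bigcup_le _ _) (leqnn _)) _.
rewrite /not_good_const !big_distrl /=; apply: leq_sum => i _.
apply: leq_trans (leq_mul (card_bigcup_le _ _) (leqnn _)) _; rewrite big_distrl /=.
apply: (@leq_trans (\sum_(J : {set 'I_k} | #|J| == (k - i)%N)
   elim_card k (D i) * #|{: sample F k d}|)%N); last first.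
  rewrite sum_nat_const -!mulnA leq_mul2r; apply/orP; right.
  apply: leq_trans (max_card _) _.
  by rewrite -cardsT -powersetT card_powerset cardsT card_ord.
apply: leq_sum => J /eqP cJ.
(* Since [i < t <= k], the set [J] contains a variable to randomize. *)
have [j jJ] : exists j, j \in J.
  by apply/card_gt0P; rewrite cJ subn_gt0 (leq_trans (ltn_ord i)).
(* All stages share the exponent [dmin d], which is at most [(d i).+1]. *)
apply: leq_trans (card_bad cJ jJ); rewrite leq_mul2l leq_pexp2l ?orbT //.
  by apply/card_gt0P; exists 0.
by apply: leq_trans (dmin_le i) _.
Qed.

Lemma prob_le_not_good (E : sample F k d -> Prop) :
  (forall w, E w -> ~ good t (D t) (polys w)) ->
  prob E <= not_good_const.+1%:R * (#|F|%:R ^- dmin d).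
Proof.
move=> Ebad; have F_gt0 : (0 < #|F|)%N by apply/card_gt0P; exists 0.
have T_gt0 : (0 < #|{: sample F k d}|)%N.
  by apply/card_gt0P; exists (finfun (fun=> 0)).
rewrite /prob ler_pdivrMr ?ltr0n // mulrAC ler_pdivlMr ?exprn_gt0 ?ltr0n //.
rewrite -natrX -!natrM ler_nat; apply: leq_trans (_ : not_good_const * _ <= _)%N.
  apply: leq_trans card_not_good; rewrite leq_mul2r; apply/orP; right.
  apply: subset_leq_card; apply/subsetP => w; rewrite !inE.
  by move=> /classical_decP/Ebad ngood; apply/classical_decP.
by rewrite leq_mul2r leqnSn orbT.
Qed.

End Counting.

(** * Dimension *)

Section Dimension.
Variables (L : closedFieldType) (k : nat).
Implicit Types (V Z : aset L k) (p q : {mpoly L[k]}).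

Definition vanish Z p := forall x, Z x -> p.@[x] = 0.

Lemma ideal_vanish Z : ideal (vanish Z).
Proof.
split=> [x _|p q p0 q0 x Zx|a p p0 x Zx]; first by rewrite meval0.
  by rewrite mevalD p0 // q0 // addr0.
by rewrite mevalM p0 // mulr0.
Qed.

(** The zero sets of [p] and [q] are closed and cover [Z], so irreducibility puts [Z] inside one of
    them. *)
Lemma vanish_prime Z p q :
  irreducible_closed Z -> vanish Z (p * q) -> vanish Z p \/ vanish Z q.
Proof.
case=> _ _ irrZ pq0; have closed1 (r : {mpoly L[k]}) : zariski_closed (fun x => r.@[x] = 0).
  by exists (eq r) => x; split=> [rx _ <-|/(_ r erefl)].
have [x /pq0/eqP | p0 | q0] := irrZ _ _ (closed1 p) (closed1 q).
- by rewrite mevalM mulf_eq0 => /orP[]/eqP; [left | right].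
- by left.
by right.
Qed.

(** Nested pairs let an induction on [r] split off the exponent of the last function. *)
Fixpoint exponents (M r : nat) : finType :=
  if r is r'.+1 then (exponents M r' * 'I_M)%type else unit.

Fixpoint power_product (g : nat -> {mpoly L[k]}) (M r : nat) :
    exponents M r -> {mpoly L[k]} :=
  if r is r'.+1 return exponents M r -> {mpoly L[k]}
  then fun a => power_product g a.1 * g r' ^+ a.2 else fun _ => 1.

Lemma card_exponents M r : #|exponents M r| = (M ^ r)%N.
Proof.
elim: r => [|r IHr] /=; first by rewrite card_unit.
by rewrite card_prod IHr card_ord expnSr.
Qed.

Lemma supp_in_power_product g G M r (a : exponents M r) :
  (forall i, (i < r)%N -> supp_in setT G (g i)) ->
  supp_in setT (r * (M * G)) (power_product g a).
Proof.
elim: r a => [|r IHr] /= a gG; first by rewrite mul0n; exact: supp_in1.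
rewrite mulSnr; apply: supp_inM; first by apply: IHr => i lt_i; apply: gG; exact: ltnW.
apply: (@supp_inW _ _ _ (a.2 * G)); first by rewrite leq_mul2r ltnW ?orbT.
by apply: supp_in_exp; exact: gG.
Qed.

(* The lowest power of g_r can be divided out on the irreducible set Z_(r+1);
   restricting to Z_r, where g_r vanishes, leaves a relation among the other g_i. *)
Lemma power_product_free (Z : nat -> aset L k) (g : nat -> {mpoly L[k]}) M n r
    (c : exponents M r -> L) :
  (forall i, (i <= n)%N -> irreducible_closed (Z i)) ->
  (forall i x, (i < n)%N -> Z i x -> Z i.+1 x) ->
  (forall i, (i < n)%N -> vanish (Z i) (g i)) ->
  (forall i, (i < n)%N -> ~ vanish (Z i.+1) (g i)) ->
  (r <= n)%N ->
  vanish (Z r) (\sum_a c a *: power_product g a) -> forall a, c a = 0.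
Proof.
move=> irrZ subZ g0 g_neq0; elim: r c => [|r IHr] c le_r c0 a.
  have [_ [x Zx] _] := irrZ 0%N le_r.
  have := c0 x Zx; rewrite (big_pred1 a) => [|b]; last by case: a b => [] [].
  by rewrite mevalZ meval1 mulr1.
pose h (e : 'I_M) := \sum_(b : exponents M r) c (b, e) *: power_product g b.
have sumE : \sum_(b : exponents M r.+1) c b *: power_product g b =
    \sum_(e < M) h e * g r ^+ e.
  under [RHS]eq_bigr do rewrite mulr_suml.
  rewrite [RHS]exchange_big pair_bigA /=; apply: eq_bigr => -[b e] _ /=.
  by rewrite scalerAl.
suff c_e : forall e : 'I_M, forall b, c (b, e) = 0 by case: a => b e; exact: c_e.
move=> e; have [m] := ubnP (e : nat); elim: m e => // m IHm e le_e.
have h0 (e' : 'I_M) : (e' < e)%N -> h e' = 0.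
  move=> lt_e'; rewrite /h big1 // => b _; rewrite IHm ?scale0r //.
  exact: leq_trans lt_e' _.
pose u := \sum_(e' < M | (e <= e')%N) h e' * g r ^+ (e' - e).
have sumu : \sum_(b : exponents M r.+1) c b *: power_product g b = g r ^+ e * u.
  rewrite sumE (bigID (fun e' : 'I_M => (e <= e')%N)) /= [X in _ + X]big1 => [|e'].
    rewrite addr0 mulr_sumr; apply: eq_bigr => e' le_e'.
    by rewrite mulrCA -exprD subnKC.
  by rewrite -ltnNge => /h0 ->; rewrite mul0r.
have u0 : vanish (Z r.+1) u.
  have g_exp n' : ~ vanish (Z r.+1) (g r ^+ n').
    elim: n' => [|n' IHn] gn0.
      have [_ [x Zx] _] := irrZ r.+1 le_r; have := gn0 x Zx.
      by rewrite expr0 meval1 => /eqP; rewrite oner_eq0.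
    rewrite exprS in gn0.
    by case: (vanish_prime (irrZ _ le_r) gn0) => //; exact: g_neq0.
  rewrite sumu in c0.
  by case: (vanish_prime (irrZ _ le_r) c0) => // /g_exp.
apply: IHr; first exact: ltnW.
move=> x Zx; rewrite -/(h e); have := u0 x (subZ _ _ le_r Zx).
rewrite /u (bigD1 e) //= mevalD subnn expr0 mulr1.
rewrite [X in _ + X = 0 -> _]raddf_sum /= [X in _ + X]big1 ?addr0 //.
move=> e' /andP[le_e' ne_e']; rewrite mevalM rmorphXn /= (g0 r) // expr0n.
have -> : (e' - e == 0)%N = false.
  by rewrite subn_eq0 leqNgt ltn_neqAle le_e' andbT eq_sym val_eqE ne_e'.
by rewrite mulr0.
Qed.

(** A chain up to [Z r.+1] gives [r + 1] functions with [M ^ r.+1] independent power products on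
    [Z r.+1]. Their degrees are linear in [M], while the relations leave only [O(M ^ r)] reduced
    monomials. *)
Lemma not_dim_gt V r D : (0 < D)%N ->
  (forall J : {set 'I_k}, #|J| = r.+1 ->
     exists P : {mpoly L[k]}, [/\ P != 0, supp_in J D P & vanish V P]) ->
  ~ dim_gt V r.
Proof.
move=> D_gt0 relV [Z [irrZ ZV stepZ]].
have [g gP] : exists g : nat -> {mpoly L[k]}, forall i, (i < r.+1)%N ->
    vanish (Z i) (g i) /\ ~ vanish (Z i.+1) (g i).
  apply: (choice (fun i gi => (i < r.+1)%N -> vanish (Z i) gi /\ ~ vanish (Z i.+1) gi)).
  move=> i; case: (ltnP i r.+1) => [lt_i|]; last by exists 0.
  have [_ [x [Zx nZx]]] := stepZ i lt_i.
  have [[Q QP] _ _] := irrZ i (ltnW lt_i).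
  (* A point of [Z i.+1] outside [Z i] violates one of the equations defining [Z i]. *)
  have [p Qp px] : exists2 p, Q p & p.@[x] <> 0.
    apply: NNPP => nex; apply: nZx; apply/QP => p Qp.
    by apply: NNPP => px; apply: nex; exists p.
  exists p => _; split=> [y /QP/(_ p Qp) // | /(_ x Zx)//].
pose G := \max_(i < r.+1) msize (g i).
have gG i : (i < r.+1)%N -> supp_in setT G (g i).
  move=> lt_i; apply: supp_in_setT; apply: leqW.
  exact: (leq_bigmax (Ordinal lt_i)).
(* The products have degree below [(r.+1 * G).+1 * M], so at most [B * M ^ r < M ^ r.+1] reduced
   monomials occur. *)
pose B := (2 ^ k * D ^ k * (r.+1 * G).+1 ^ r)%N; pose M := B.+1.
have relZ (J : {set 'I_k}) : #|J| = r.+1 ->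
    exists P : {mpoly L[k]}, [/\ P != 0, supp_in J D P & vanish (Z r.+1) P].
  move=> /relV[P [P_neq0 PJ P0]]; exists P; split=> // x Zx.
  by apply: P0; exact: ZV Zx.
have [c [a _ ca] c0] : exists2 c, (exists2 a, a \in setT & c a != 0) &
    vanish (Z r.+1) (\sum_(a in setT) c a *: power_product g (a : exponents M r.+1)).
  apply: (exists_relation_mod (N := r.+1 * (M * G)) (ideal_vanish _) relZ D_gt0).
    by move=> a _; apply: (@msize_supp_in _ _ setT); exact: supp_in_power_product.
  rewrite cardsT card_exponents.
  apply: (@leq_ltn_trans (2 ^ k * D ^ k * ((r.+1 * G).+1 * M) ^ r))%N.
    rewrite leq_mul2l; apply/orP; right; case: (r) => // r'; rewrite leq_exp2r //.
    by rewrite mulSn mulnCA [(M * (_ * _))%N]mulnC /M; lia.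
  by rewrite expnMn mulnA -/B expnS ltn_pmul2r ?expn_gt0.
case/eqP: ca; apply: (power_product_free (n := r.+1) (Z := Z) (g := g)) (leqnn _) _ a => //.
- by move=> i x lt_i; have [sub _] := stepZ i lt_i; exact: sub.
- by move=> i /gP[].
- by move=> i /gP[].
by move=> x /c0; under eq_bigl do rewrite inE.
Qed.

End Dimension.

Lemma vanish_variety (F : fieldType) (L : closedFieldType) (iota : {rmorphism F -> L})
    k t i (f : 'I_t -> {mpoly F[k]}) P :
  in_ideal i f P -> vanish (variety iota f) (map_mpoly iota P).
Proof.
case=> h -> x Vx; rewrite (raddf_sum (map_mpoly iota)) (raddf_sum (meval x)) big1 // => l _ /=.
by rewrite rmorphM mevalM Vx mulr0.
Qed.

(** The relations are carried to [L] by [iota], whose injectivity preserves their supports. *)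
Lemma good_not_dim_gt (F : fieldType) (L : closedFieldType) (iota : {rmorphism F -> L})
    k t D (f : 'I_t -> {mpoly F[k]}) :
  (0 < D)%N -> good t D f -> ~ dim_gt (variety iota f) (k - t).
Proof.
move=> D_gt0 goodf; apply: (not_dim_gt D_gt0) => J /goodf[P [P_neq0 PJ IP]].
exists (map_mpoly iota P); split; last exact: vanish_variety IP.
  apply: contra_neq P_neq0 => P0; apply/mpolyP => m; apply: (fmorph_inj iota).
  by rewrite -mcoeff_map_mpoly P0 !mcoeff0 rmorph0.
by move=> m; rewrite (perm_mem (msupp_map_mpoly _ (fmorph_inj iota))); exact: PJ.
Qed.

(** * Relations among the powers of a system of parameters *)

Section Local.
Variables (k : nat) (F : fieldType).
Implicit Types (p q : {mpoly F[k]}) (f : 'I_k -> {mpoly F[k]}) (a b m : 'X_{1..k}).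

Definition mon_prod f a := \prod_(i < k) f i ^+ a i.

Lemma mon_prodD f a b : mon_prod f (a + b)%MM = mon_prod f a * mon_prod f b.
Proof. by rewrite /mon_prod -big_split; apply: eq_bigr => i _; rewrite mnmDE exprD. Qed.

Lemma mon_prod0 f : mon_prod f 0%MM = 1.
Proof. by rewrite /mon_prod big1 // => i _; rewrite mnm0E expr0. Qed.

Lemma mon_prodU f i : mon_prod f U_(i)%MM = f i.
Proof.
rewrite /mon_prod (bigD1 i) //= mnm1E eqxx expr1 big1 ?mulr1 // => l ne_l.
by rewrite mnm1E eq_sym (negPf ne_l) expr0.
Qed.

(** Membership in the [n]-th power of the maximal ideal at the origin. *)
Definition ord_ge n p := forall m, (mdeg m < n)%N -> p@_m = 0.

Lemma ord_geM n n' p q : ord_ge n p -> ord_ge n' q -> ord_ge (n + n') (p * q).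
Proof.
move=> pn qn m lt_m; apply/eqP; rewrite mcoeff_eq0; apply: contraL lt_m.
move=> /msuppM_le /allpairsP[[m1 m2] /= [m1p m2q ->]]; rewrite -leqNgt mdegD.
apply: leq_add; rewrite leqNgt; [apply: contraL m1p => /pn | apply: contraL m2q => /qn];
  by rewrite mcoeff_msupp negbK => /eqP.
Qed.

Lemma ord_ge_exp n p e : ord_ge n p -> ord_ge (e * n) (p ^+ e).
Proof.
move=> pn; elim: e => [|e IHe] //; rewrite mulSn exprS; exact: ord_geM.
Qed.

Lemma ord_geW n n' p : (n <= n')%N -> ord_ge n' p -> ord_ge n p.
Proof. by move=> le_n pn m lt_m; apply: pn; exact: leq_trans le_n. Qed.

Lemma ideal_ord_ge n : ideal (ord_ge n).
Proof.
split=> [m _|p q pn qn m lt_m|a p pn]; first exact: mcoeff0.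
  by rewrite mcoeffD pn // qn // addr0.
by rewrite -[n]add0n; apply: ord_geM.
Qed.

Lemma ord_ge1 p : p@_0%MM = 0 -> ord_ge 1 p.
Proof. by move=> p0 m; rewrite ltnS leqn0 mdeg_eq0 => /eqP ->. Qed.

Lemma ord_ge_mon_prod f a : (forall i, (f i)@_0%MM = 0) -> ord_ge (mdeg a) (mon_prod f a).
Proof.
move=> f0; rewrite mdegE /mon_prod; elim/big_rec2: _ => [//|i p n _ pn].
by apply: ord_geM => //; have := @ord_ge_exp _ _ (a i) (ord_ge1 (f0 i)); rewrite muln1.
Qed.

(** Normalize the constant term to 1 and truncate the geometric series after [n] terms. *)
Lemma inverse_mod_ord_ge n p : p@_0%MM != 0 -> exists q, ord_ge n (p * q - 1).
Proof.
move=> p0; pose c := (p@_0%MM)^-1; pose w := 1 - c *: p.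
have w1 : ord_ge 1 w.
  by apply: ord_ge1; rewrite mcoeffB mcoeffZ mcoeff1 eqxx mulVf ?subrr.
exists (c *: \sum_(i < n) w ^+ i).
have -> : p * (c *: \sum_(i < n) w ^+ i) - 1 = - w ^+ n.
  have -> : p * (c *: \sum_(i < n) w ^+ i) = - ((w - 1) * \sum_(i < n) w ^+ i).
    have -> : w - 1 = - (c *: p) by rewrite /w addrAC subrr sub0r.
    by rewrite mulNr opprK -scalerAr scalerAl.
  by rewrite -subrX1 opprB addrAC subrr sub0r.
have [_ _ oM] := ideal_ord_ge n.
rewrite -mulN1r; apply: oM; rewrite -[n in ord_ge n]muln1; exact: ord_ge_exp.
Qed.

(** * Spanning the local ring at the origin under a relation raising [f^a0] *)

Section Contradiction.
Variables (f : 'I_k -> {mpoly F[k]}) (E : nat) (a0 : 'X_{1..k}) (u0 : {mpoly F[k]}).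
Variables (T : finType) (P : pred T) (b : T -> 'X_{1..k}) (h : T -> {mpoly F[k]}).
Hypothesis f0 : forall i, (f i)@_0%MM = 0.
Hypothesis fE : forall j, exists2 u, u@_0%MM != 0 & in_ideal k f (u * 'X_j ^+ E).
Hypothesis u0_neq0 : u0@_0%MM != 0.
Hypothesis lt_b : forall x, P x -> (a0 < b x)%O.
Hypothesis rel0 : mon_prod f a0 * u0 = \sum_(x | P x) mon_prod f (b x) * h x.
Variable n : nat.

Let index : finType := ({ffun 'I_k -> 'I_n} * {ffun 'I_k -> 'I_E})%type.

Definition normal_index : {set index} :=
  setX [set a : {ffun 'I_k -> 'I_n} | ~~ (a0 <= mnm_of a)%MM] setT.

Definition normal_elt (x : index) := mon_prod f (mnm_of x.1) * 'X_[mnm_of x.2].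

(** The sum of the ideal of [f] and the [n]-th power of the maximal ideal. *)
Let J p := exists h, ord_ge n (p - \sum_i h i * f i).

Lemma ideal_sum_ord_ge : ideal J.
Proof.
have [o0 oD oM] := ideal_ord_ge n; split.
- by exists (fun=> 0); rewrite big1 ?subr0 // => i _; rewrite mul0r.
- move=> p q [hp Ip] [hq Iq]; exists (fun i => hp i + hq i).
  under eq_bigr do rewrite mulrDl.
  by rewrite big_split /= opprD addrACA; exact: oD.
move=> a p [hp Ip]; exists (fun i => a * hp i).
under eq_bigr do rewrite -mulrA.
by rewrite -mulr_sumr -mulrBr; exact: oM.
Qed.

(** Each ['X_j ^+ E] lies in [J], because its multiplier [u] is invertible modulo order [n]; only
    exponents below [E] remain. *)
Lemma box_span p : in_span J setT (fun c : {ffun 'I_k -> 'I_E} => 'X_[mnm_of c]) p.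
Proof.
have idJ := ideal_sum_ord_ge; have subJ := ideal_subspace idJ; have [_ JD JM] := idJ.
rewrite (mpolyE p); apply: (in_span_sum subJ) => m _; apply: (in_spanZ subJ).
have [/forallP lt_m | ] := boolP [forall i, (m i < E)%N].
  by have [c <-] := mnm_ofP lt_m; apply: (mem_in_span _ subJ).
rewrite negb_forall => /existsP[j]; rewrite -leqNgt => le_E.
apply: in_span_sub.
have -> : 'X_[m] = 'X_[m - U_(j) *+ E] * 'X_j ^+ E :> {mpoly F[k]}.
  rewrite mpolyXn -mpolyXD submK //; apply/mnm_lepP => i.
  by rewrite mulmnE mnm1E; case: eqP => [<-|_]; rewrite ?mul1n ?mul0n.
apply: (JM); have [u u_neq0 [g gE]] := fE j.
have [v uv] := inverse_mod_ord_ge n u_neq0.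
have -> : 'X_j ^+ E = - 'X_j ^+ E * (u * v - 1) + v * (u * 'X_j ^+ E) :> {mpoly F[k]} by ring.
have [_ _ oM] := ideal_ord_ge n.
apply: JD; first by exists (fun=> 0); rewrite big1 ?subr0 => [|i _]; [exact: oM | rewrite mul0r].
apply: JM; exists g; rewrite gE; under eq_bigl do rewrite ltn_ord.
by rewrite subrr; case: (ideal_ord_ge n).
Qed.

(** Induction on decreasing [a]: a multiple of [f^a0] is raised by the relation, and otherwise [p]
    is reduced to box monomials plus multiples of the [f i], which raise [a]. From degree [n] on,
    [f^a] vanishes modulo order [n]. *)
Lemma normal_span a p : in_span (ord_ge n) normal_index normal_elt (mon_prod f a * p).
Proof.
have idO := ideal_ord_ge n; have subO := ideal_subspace idO; have [_ _ oM] := idO.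
pose rank a := #|[set c : 'X_{1..k < n} | (a < c)%O]|.
have [N] := ubnP (rank a); elim: N a p => // N IHN a p le_N.
have [le_n | lt_n] := leqP n (mdeg a).
  apply: in_span_sub; rewrite mulrC; apply: oM.
  exact: ord_geW le_n (ord_ge_mon_prod f0).
have IHa a' q : (a < a')%O -> in_span (ord_ge n) normal_index normal_elt (mon_prod f a' * q).
  move=> lt_a; have [le_n' | lt_n'] := leqP n (mdeg a').
    apply: in_span_sub; rewrite mulrC; apply: oM.
    exact: ord_geW le_n' (ord_ge_mon_prod f0).
  apply: IHN; rewrite -ltnS; apply: leq_trans le_N; rewrite ltnS; apply: proper_card.
  apply/properP; split; first by apply/subsetP => c; rewrite !inE; exact: lt_trans.
  by exists (BMultinom lt_n'); rewrite !inE //= ltxx.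
have [le_a | nle_a] := boolP (a0 <= a)%MM.
  have [v uv] := inverse_mod_ord_ge n u0_neq0.
  apply: (in_span_congr subO (w := \sum_(x | P x)
      mon_prod f (a - a0 + b x)%MM * (h x * v * p))).
    have -> : \sum_(x | P x) mon_prod f (a - a0 + b x)%MM * (h x * v * p) =
        mon_prod f (a - a0)%MM * v * p * (mon_prod f a0 * u0).
      by rewrite rel0 mulr_sumr; apply: eq_bigr => x _; rewrite mon_prodD; ring.
    rewrite -{1}(submK le_a) mon_prodD.
    have -> : mon_prod f (a - a0)%MM * mon_prod f a0 * p -
        mon_prod f (a - a0)%MM * v * p * (mon_prod f a0 * u0) =
        - (mon_prod f (a - a0)%MM * mon_prod f a0 * p) * (u0 * v - 1) by ring.
    exact: oM.
  apply: (in_span_sum subO) => x Px; apply: IHa.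
  by rewrite -[X in (X < _)%O](submK le_a) ltmc_add2r lt_b.
have [c [g cg]] := box_span p.
apply: (in_span_congr subO (w := mon_prod f a *
    (\sum_(d in setT) c d *: 'X_[mnm_of d] + \sum_i g i * f i))).
  by rewrite -mulrBr; apply: oM; rewrite opprD addrA.
rewrite mulrDr !mulr_sumr; apply: (in_spanD subO).
  apply: (in_span_sum subO) => d _.
  have lt_a i : (a i < n)%N by exact: leq_ltn_trans (mnm_le_mdeg _ _) lt_n.
  rewrite -scalerAr; apply: (in_spanZ subO).
  have [d' d'E] := mnm_ofP lt_a.
  rewrite -d'E; apply: (mem_in_span normal_elt subO (b := (d', d))).
  by rewrite !inE /= d'E nle_a.
apply: (in_span_sum subO) => i _.
have -> : mon_prod f a * (g i * f i) = mon_prod f (a + U_(i))%MM * g i.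
  by rewrite mon_prodD mon_prodU; ring.
apply: IHa; rewrite -[X in (X < _)%O]addm0 ltmc_add2r.
by rewrite lt_neqAle le0m andbT eq_sym mnm1_eq0.
Qed.

(** An exponent not above [a0] has some coordinate [i] below [a0 i], the others being free; summing
    over [i] gives [mdeg a0]. *)
Lemma card_normal_index : (#|normal_index| <= mdeg a0 * n ^ k.-1 * E ^ k)%N.
Proof.
rewrite cardsX cardsT card_ffun !card_ord leq_mul2r; apply/orP; right.
pose R (i l : 'I_k) : pred 'I_n := [pred x : 'I_n | (l == i) ==> (x < a0 i)%N].
have sub : [set a : {ffun 'I_k -> 'I_n} | ~~ (a0 <= mnm_of a)%MM] \subset
    \bigcup_i [set a in family (R i)].
  apply/subsetP => a; rewrite inE => /mnm_lepP nle.
  have [/forallP le_a | ] := boolP [forall i, (a0 i <= mnm_of a i)%N].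
    by case: nle.
  rewrite negb_forall => /existsP[i]; rewrite -ltnNge mnmE => lt_i.
  apply/bigcupP; exists i => //; rewrite inE; apply/familyP => l; rewrite inE.
  by apply/implyP => /eqP ->.
apply: leq_trans (subset_leq_card sub) _; apply: leq_trans (card_bigcup_le _ _) _.
rewrite mdegE big_distrl /=; apply: leq_sum => i _.
rewrite cardsE card_family foldrE big_map big_enum /= (bigD1 i) //=.
apply: leq_mul.
  apply: leq_trans (card_ord_lt n (a0 i)); apply: subset_leq_card.
  by apply/subsetP => x; rewrite !inE eqxx.
apply: leq_trans (_ : \prod_(l < k | l != i) n <= _)%N.
  by apply: leq_prod => l _; apply: leq_trans (max_card _) _; rewrite card_ord.
by rewrite prod_nat_const cardC1 card_ord.
Qed.

End Contradiction.

(* R is spanned modulo the ideal of order n by about n^(k-1) elements f^c x^d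
   (c not above a0), while its dimension grows like n^k. *)
Lemma no_higher_order_relation f E a0 u0 (T : finType) (P : pred T)
    (b : T -> 'X_{1..k}) (h : T -> {mpoly F[k]}) :
  (0 < k)%N -> (forall i, (f i)@_0%MM = 0) ->
  (forall j, exists2 u, u@_0%MM != 0 & in_ideal k f (u * 'X_j ^+ E)) ->
  u0@_0%MM != 0 -> (forall x, P x -> (a0 < b x)%O) ->
  mon_prod f a0 * u0 <> \sum_(x | P x) mon_prod f (b x) * h x.
Proof.
move=> k_gt0 f0 fE u0_neq0 lt_b rel0.
(* With [n = k * N], the [N ^ k] monomials with exponents below [N] have degree below [n], while the
   spanning set has at most [B * N ^ k.-1] elements. *)
pose B := (mdeg a0 * k ^ k.-1 * E ^ k)%N; pose N := B.+1; pose n := (k * N)%N.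
have [c [a _ ca] c0] : exists2 c, (exists2 a, a \in setT & c a != 0) &
    ord_ge n (\sum_(a in setT) c a *: 'X_[mnm_of (a : {ffun 'I_k -> 'I_N})]).
  have subO := ideal_subspace (ideal_ord_ge n).
  have spanX (a : {ffun 'I_k -> 'I_N}) : a \in setT ->
      in_span (ord_ge n) (normal_index E a0 n) (normal_elt f (n := n)) 'X_[mnm_of a].
    move=> _; rewrite -['X_[_]]mul1r -(mon_prod0 f).
    exact: normal_span f0 fE u0_neq0 lt_b rel0 n _ _.
  apply: (exists_relation subO spanX).
  apply: leq_ltn_trans (card_normal_index _ _ _) _.
  rewrite cardsT card_ffun !card_ord /n expnMn.
  have -> : (N ^ k = N * N ^ k.-1)%N by rewrite -expnS prednK.
  have -> : (mdeg a0 * (k ^ k.-1 * N ^ k.-1) * E ^ k = B * N ^ k.-1)%N.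
    by rewrite /B; ring.
  by rewrite ltn_pmul2r // expn_gt0.
case/eqP: ca; have lt_a : (mdeg (mnm_of a) < n)%N.
  apply: leq_ltn_trans (mdeg_mnm_of _) _.
  by rewrite /n /N mulnS -[X in (X < _)%N]add0n ltn_add2r.
have := c0 _ lt_a; rewrite linear_sum /= (bigD1 a) ?inE //= mcoeffZ mcoeffX eqxx mulr1.
rewrite big1 ?addr0 // => a' /andP[_ ne]; rewrite mcoeffZ mcoeffX.
by rewrite (inj_eq (@mnm_of_inj _ _)) (negPf ne) mulr0.
Qed.

End Local.

(** * Growth estimates *)

Section Growth.

(** The first two terms of the binomial expansion each equal [x ^ x]. *)
Lemma bernoulli_exp x : (0 < x)%N -> (2 * x ^ x <= x.+1 ^ x)%N.
Proof.
case: x => // x _; rewrite -[x.+2]addn1 Pascal big_ord_recl big_ord_recl /=.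
by rewrite !exp1n bin0 bin1 /bump /= subn0 subSS subn0 !muln1 !mul1n -expnS; lia.
Qed.

Lemma linear_lt_exp c : (c * c.+1 + 1 < 4 ^ c.+1)%N.
Proof.
have := ltn_expl c.+1 (isT : 1 < 2)%N => lt2.
have -> : (4 ^ c.+1 = 2 ^ c.+1 * 2 ^ c.+1)%N by rewrite -expnMn.
by apply: leq_trans (leq_mul lt2 lt2); lia.
Qed.

Lemma exp_beats_poly D M k : (0 < D)%N ->
  exists j, (D ^ j * (j * M).+1 ^ k < D.+1 ^ j)%N.
Proof.
move=> D_gt0; have [-> | k_gt0] := posnP k; first by exists 1%N; rewrite expn0 !expn1 muln1.
(* For [j = D * l] one gets [j * M + 1 = c * c.+1 + 1], while the gain [2 ^ l] equals
   [(4 ^ c.+1) ^ k]. *)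
pose c := (2 * k * D * M)%N; pose l := (2 * (k * c.+1))%N.
have le2 l' : (2 ^ l' * D ^ (D * l') <= D.+1 ^ (D * l'))%N.
  rewrite !expnM -expnMn; case: l' => // l'.
  by rewrite leq_exp2r // bernoulli_exp.
exists (D * l)%N; apply: leq_trans (le2 l); rewrite mulnC ltn_pmul2r ?expn_gt0 ?D_gt0 //.
have -> : (2 ^ l = (4 ^ c.+1) ^ k)%N by rewrite -expnM /l expnM mulnC.
rewrite ltn_exp2r //; apply: leq_ltn_trans (linear_lt_exp c).
by rewrite /l /c; lia.
Qed.

(** Growth by a factor [(D + 1) / D] at every step of length [M] would be exponential, against the
    polynomial bound. *)
Lemma slow_growth_step (a : nat -> nat) D M k : (0 < D)%N -> (0 < a 0)%N ->
  (forall N, a N <= N.+1 ^ k)%N -> exists N, (D * a (N + M)%N < D.+1 * a N)%N.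
Proof.
move=> D_gt0 a0_gt0 le_a; apply: NNPP => nstep.
have step N : (D.+1 * a N <= D * a (N + M))%N.
  by rewrite leqNgt; apply/negP => lt_N; apply: nstep; exists N.
have grow j : (D.+1 ^ j * a 0 <= D ^ j * a (j * M))%N.
  elim: j => // j IHj; have := step (j * M)%N; rewrite -mulSnr => stepj.
  apply: leq_trans (_ : D ^ j * (D.+1 * a (j * M)) <= _)%N.
    by rewrite expnS -mulnA [leqRHS]mulnCA leq_mul2l IHj orbT.
  by rewrite expnSr -mulnA leq_mul2l stepj orbT.
have [j] := exp_beats_poly M k D_gt0; rewrite ltnNge => /negP; apply.
apply: leq_trans (leq_mul (leqnn (D ^ j)) (le_a _)).
by apply: leq_trans (grow j); rewrite leq_pmulr.
Qed.

End Growth.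

Lemma card_bmultinom_le k N : (#|{: 'X_{1..k < N.+1}}| <= N.+1 ^ k)%N.
Proof.
rewrite -[k in leqRHS]card_ord -[N.+1 in leqRHS]card_ord -card_ffun.
have lt_m (m : 'X_{1..k < N.+1}) i : (m i < N.+1)%N.
  by apply: leq_ltn_trans (mnm_le_mdeg _ _) (bmdeg m).
apply: (leq_card (fun m : 'X_{1..k < N.+1} => [ffun i => Ordinal (lt_m m i)])).
move=> m m' /ffunP eq_m; apply/val_inj/mnmP => i.
by have /(congr1 val) := eq_m i; rewrite !ffunE.
Qed.

Definition weighted_exponents k (d : 'I_k -> nat) N : {set 'X_{1..k < N.+1}} :=
  [set m : 'X_{1..k < N.+1} | (\sum_i m i * d i <= N)%N].

(* Euclidean division of exponents by the d_i. *)
Lemma card_weighted_exponents k (d : 'I_k -> nat) N : (forall i, (0 < d i)%N) ->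
  (#|{: 'X_{1..k < N.+1}}| <= (\prod_i d i) * #|weighted_exponents d N|)%N.
Proof.
move=> d_gt0; pose quo (m : 'X_{1..k}) : 'X_{1..k} := [multinom m i %/ d i | i < k].
have quo_lt (m : 'X_{1..k < N.+1}) : (mdeg (quo m) < N.+1)%N.
  apply: leq_ltn_trans (bmdeg m); rewrite !mdegE; apply: leq_sum => i _.
  by rewrite mnmE leq_div.
pose split (m : 'X_{1..k < N.+1}) : {dffun forall i, 'I_(d i)} * 'X_{1..k < N.+1} :=
  (finfun (fun i => Ordinal (ltn_pmod (m i) (d_gt0 i))), BMultinom (quo_lt m)).
have split_inj : injective split.
  move=> m m' eq_split; apply/val_inj/mnmP => i /=.
  have /ffunP/(_ i)/(congr1 val) := congr1 fst eq_split; rewrite !ffunE /= => eq_i.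
  have /mnmP/(_ i) := congr1 (fun y => bmnm y.2) eq_split; rewrite !mnmE => eq_q.
  by rewrite (divn_eq (m i) (d i)) eq_i eq_q -divn_eq.
have -> : (\prod_i d i = #|{: {dffun forall i, 'I_(d i)}}|)%N.
  by rewrite card_dep_ffun foldrE big_map big_enum; apply: eq_bigr => i _; rewrite card_ord.
rewrite -[X in (_ <= X * _)%N]cardsT -cardsX -[leqLHS]cardsT -(card_imset _ split_inj).
apply: subset_leq_card.
apply/subsetP => _ /imsetP[m _ ->]; rewrite !inE /=.
apply: leq_trans (_ : mdeg m <= N)%N; last by rewrite -ltnS bmdeg.
by rewrite mdegE; apply: leq_sum => i _; rewrite mnmE leq_trunc_div.
Qed.

(** * Moving a zero to the origin *)

Section Translation.
Variables (F : fieldType) (k : nat) (x : 'I_k -> F).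
Implicit Types (p : {mpoly F[k]}).

Lemma mcoeff0_meval p : p@_0%MM = p.@[fun=> 0].
Proof.
rewrite {1}(mpolyE p) [in RHS](mpolyE p) !raddf_sum; apply: eq_bigr => m _ /=.
rewrite mcoeffZ mevalZ mcoeffX mevalX; congr (_ * _).
have [-> | m_neq0] := eqVneq m 0%MM.
  by rewrite big1 // => i _; rewrite mnm0E expr0.
have [i mi] : exists i, m i != 0%N.
  apply/existsP; rewrite -negb_forall; apply: contraNN m_neq0 => /forallP m0.
  by apply/eqP/mnmP => i; rewrite mnm0E; apply/eqP.
by rewrite (bigD1 i) //= expr0n (negPf mi) mul0r.
Qed.

Definition translate : {mpoly F[k]} -> {mpoly F[k]} :=
  comp_mpoly [tuple 'X_i + (x i)%:MP | i < k].

HB.instance Definition _ := GRing.RMorphism.copy translate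
  (comp_mpoly [tuple 'X_i + (x i)%:MP | i < k]).

Lemma mcoeff0_translate p : (translate p)@_0%MM = p.@[x].
Proof.
rewrite mcoeff0_meval /translate comp_mpoly_meval; apply: meval_eq => i.
by rewrite tnth_mktuple mevalD mevalXU mevalC add0r.
Qed.

Lemma translateU i : translate 'X_i = 'X_i + (x i)%:MP.
Proof. by rewrite /translate comp_mpolyXU -tnth_nth tnth_mktuple. Qed.

(** Split off the full power of [X - x j] from [p] as a univariate polynomial; the cofactor is
    nonzero at [x j], so it becomes a unit at the origin. *)
Lemma translate_univariate n p j : p != 0 -> supp_in [set j] n p ->
  exists e u, u@_0%MM != 0 /\ translate p = u * 'X_j ^+ e.
Proof.
move=> p_neq0 pj; pose ev (y : {mpoly F[k]}) (g : {poly F}) := (map_poly (@mpolyC k F) g).[y].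
pose g : {poly F} := \sum_(m <- msupp p) p@_m *: 'X^(m j).
have evg y : ev y g = \sum_(m <- msupp p) p@_m *: y ^+ m j.
  rewrite /ev /g rmorph_sum /= horner_sum; apply: eq_bigr => m _.
  by rewrite map_polyZ map_polyXn hornerZ hornerXn mul_mpolyC.
have pE : p = \sum_(m <- msupp p) p@_m *: 'X_j ^+ m j.
  rewrite {1}(mpolyE p); apply: eq_big_seq => m /pj[_ mj]; congr (_ *: _).
  rewrite mpolyXn; congr 'X_[_]; apply/mnmP => i; rewrite mulmnE mnm1E.
  by case: eqP => [<-|ji]; rewrite ?mul1n // mul0n mj // inE eq_sym; apply/eqP.
have g_neq0 : g != 0.
  by apply: contraNneq p_neq0 => g0; rewrite pE -evg g0 /ev rmorph0 horner0.
have [e [q qx gE]] := multiplicity_XsubC g (x j).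
rewrite g_neq0 /= in qx.
exists e, (ev ('X_j + (x j)%:MP) q); split.
  apply: contraNneq qx => q0; rewrite rootE; apply/eqP; rewrite -[RHS]q0 mcoeff0_meval /ev.
  rewrite -horner_map -map_poly_comp /= mevalD mevalXU mevalC add0r.
  by rewrite (eq_map_poly (g := id)) ?map_poly_id // => c; rewrite /= mevalC.
have -> : translate p = ev ('X_j + (x j)%:MP) g.
  rewrite evg [in LHS]pE raddf_sum; apply: eq_bigr => m _ /=.
  by rewrite [LHS]comp_mpolyZ -/translate rmorphXn /= translateU.
rewrite gE /ev rmorphM rmorphXn /= rmorphB /= map_polyX map_polyC /= hornerM horner_exp.
by rewrite hornerD hornerN hornerX hornerC addrK.
Qed.

End Translation.

(** * Bezout's bound *)

Section Interpolation.
Variables (F : finFieldType) (k : nat).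
Implicit Types s : {ffun 'I_k -> F}.

(** A Lagrange factor in the first coordinate found to differ; the default 1 occurs only for
    [s = s']. *)
Definition separator s s' : {mpoly F[k]} :=
  if [pick i | s i != s' i] is Some i then (s i - s' i)^-1 *: ('X_i - (s' i)%:MP) else 1.

Lemma separator_eq1 s s' : s' != s -> (separator s s').@[s] = 1.
Proof.
rewrite /separator; case: pickP => [i ne_i _ | eq_s /eqP[]].
  by rewrite mevalZ mevalB mevalXU mevalC mulVf // subr_eq0.
by apply/ffunP => i; have /negbFE/eqP := eq_s i.
Qed.

Lemma separator_eq0 s s' : s' != s -> (separator s s').@[s'] = 0.
Proof.
rewrite /separator; case: pickP => [i ne_i _ | eq_s /eqP[]].
  by rewrite mevalZ mevalB mevalXU mevalC subrr mulr0.
by apply/ffunP => i; have /negbFE/eqP := eq_s i.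
Qed.

Definition indicator s : {mpoly F[k]} := \prod_(s' | s' != s) separator s s'.

Lemma meval_indicator s s' : (indicator s).@[s'] = (s' == s)%:R.
Proof.
rewrite /indicator rmorph_prod /=; case: eqP => [->|/eqP ne_s].
  by rewrite big1 // => s'' /separator_eq1.
by rewrite (bigD1 s') //= separator_eq0 // mul0r.
Qed.

End Interpolation.

Section Bezout.
Variables (F : finFieldType) (k : nat) (d : 'I_k -> nat) (f : 'I_k -> {mpoly F[k]}) (D : nat).
Hypothesis k_gt0 : (0 < k)%N.
Hypothesis d_gt0 : forall i, (0 < d i)%N.
Hypothesis le_f : forall i, (msize (f i) <= (d i).+1)%N.
Hypothesis good_f : good k D f.

Let S : {set {ffun 'I_k -> F}} := [set x : {ffun 'I_k -> F} | [forall i, (f i).@[x] == 0]].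

Lemma supp_in_mon_prod (a : 'X_{1..k}) : supp_in setT (\sum_i a i * d i) (mon_prod f a).
Proof.
rewrite /mon_prod; elim/big_rec2: _ => [|i p n _ IHp]; first exact: supp_in1.
by apply: supp_inM => //; apply: supp_in_exp; exact: supp_in_setT.
Qed.

Lemma translate_ideal (x : 'I_k -> F) p :
  in_ideal k f p -> in_ideal k (fun i => translate x (f i)) (translate x p).
Proof.
case=> h ->; exists (fun i => translate x (h i)).
by rewrite rmorph_sum; apply: eq_bigr => i _; rewrite rmorphM.
Qed.

(** Goodness at stage [k] for the singletons [J] gives a univariate relation in each variable; the
    maximum of the local multiplicities serves as a common [E]. *)
Lemma power_in_translated_ideal (x : 'I_k -> F) :
  exists E, forall j, exists2 u, u@_0%MM != 0 &
    in_ideal k (fun i => translate x (f i)) (u * 'X_j ^+ E).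
Proof.
have e_ex (j : 'I_k) : exists e, exists2 u, u@_0%MM != 0 &
    in_ideal k (fun i => translate x (f i)) (u * 'X_j ^+ e).
  have [|P [P_neq0 Pj IP]] := good_f (J := [set j]); first by rewrite cards1 subnn.
  have [e [u [u_neq0 PE]]] := translate_univariate x P_neq0 Pj.
  by exists e, u => //; rewrite -PE; exact: translate_ideal.
have [e eP] := fin_all_exists e_ex.
exists (\max_j e j)%N => j; have [u u_neq0 Iu] := eP j; exists u => //.
rewrite -(subnK (leq_bigmax j : (e j <= \max_j e j)%N)) exprD mulrCA.
by have [_ _ IM] := ideal_in_ideal k (fun i => translate x (f i)); exact: IM.
Qed.

(** With too many zeros, the products of [f^a] and indicators outnumber the monomials available; the
    lowest [f^a] in a relation then contradicts [no_higher_order_relation] at some zero. *)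
Lemma bezout : (nb_rat_points f <= \prod_i d i)%N.
Proof.
rewrite /nb_rat_points -/S leqNgt; apply/negP => lt_S.
have Pd_gt0 : (0 < \prod_i d i)%N by apply: prodn_gt0.
(* Indicators raise the degree by at most [M], a loss that slow growth of the monomial count absorbs
   for a suitable [N]. *)
pose M := \max_(s : {ffun 'I_k -> F}) msize (indicator s).
have [N ltN] : exists N, (\prod_i d i * #|{: 'X_{1..k < (N + M).+1}}|
    < (\prod_i d i).+1 * #|{: 'X_{1..k < N.+1}}|)%N.
  apply: (@slow_growth_step (fun N => #|{: 'X_{1..k < N.+1}}|) _ M k) => //.
    by apply/card_gt0P; exists bm0.
  exact: card_bmultinom_le.
pose A := weighted_exponents d N.
have sub0 : subspace (fun p : {mpoly F[k]} => p = 0).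
  by split=> [//|p q -> ->|c p ->]; rewrite ?addr0 ?scaler0.
pose g (x : 'X_{1..k < N.+1} * {ffun 'I_k -> F}) := mon_prod f x.1 * indicator x.2.
have spang x : x \in setX A S ->
    in_span (fun p : {mpoly F[k]} => p = 0) setT
      (fun m : 'X_{1..k < (N + M).+1} => 'X_[m]) (g x).
  case: x => a s; rewrite inE /= inE => /andP[le_a _].
  have le_g : (msize (g (a, s)) <= (N + M).+1)%N.
    apply: (@msize_supp_in _ _ setT); apply: supp_inM.
      by apply: supp_inW le_a _; exact: supp_in_mon_prod.
    by apply: supp_in_setT; apply: leqW; exact: (leq_bigmax s).
  exists (fun m : 'X_{1..k < (N + M).+1} => (g (a, s))@_(bmnm m)); rewrite {1}(mpolywE le_g).
  by under [X in _ - X]eq_bigl do rewrite inE; rewrite subrr.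
have ltAS : (#|[set: 'X_{1..k < (N + M).+1}]| < #|setX A S|)%N.
  rewrite cardsT cardsX -(ltn_pmul2l Pd_gt0); apply: leq_trans ltN _.
  apply: leq_trans (leq_mul (leqnn _) (card_weighted_exponents N d_gt0)) _.
  by rewrite mulnCA leq_mul2l mulnC leq_mul2l lt_S !orbT.
have [c [[a1 s1] as1 c1] c0] := exists_relation sub0 spang ltAS.
pose Q a := [exists s in S, (a \in A) && (c (a, s) != 0)].
have Qa1 : Q a1.
  by move: as1; rewrite inE => /andP[a1A s1S]; apply/exists_inP; exists s1 => //; apply/andP.
pose a0 := [arg min_(a < a1 | Q a) (a : 'X_{1..k})]%O.
(* The least exponent occurring in the relation; a zero [s0] where it occurs becomes the origin. *)
have [Qa0 min_a0] : Q a0 /\ forall a : 'X_{1..k < N.+1}, Q a -> (a0 <= a :> 'X_{1..k})%O.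
  by rewrite /a0; case: arg_minP.
have [s0 s0S /andP[a0A c_s0]] := exists_inP Qa0.
have [E fE] := power_in_translated_ideal s0.
pose h a := \sum_(s in S) c (a, s) *: indicator s.
have sum0 : \sum_(a in A) mon_prod f a * h a = 0.
  transitivity (\sum_(a in A) \sum_(s in S) c (a, s) *: g (a, s)).
    by apply: eq_bigr => a _; rewrite mulr_sumr; apply: eq_bigr => s _; rewrite scalerAr.
  rewrite pair_big -[RHS]c0; by apply: eq_big => [[a s] | [a s] _] //; rewrite in_setX.
have h0 (a : 'X_{1..k < N.+1}) : a \in A -> a != a0 -> ~~ (a0 < a :> 'X_{1..k})%O -> h a = 0.
  move=> aA ne_a; rewrite /h => nlt; apply: big1 => s sS.
  have [-> | cas] := eqVneq (c (a, s)) 0; first exact: scale0r.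
  have Qa : Q a by apply/exists_inP; exists s => //; apply/andP.
  by case/negP: nlt; rewrite lt_neqAle min_a0 // andbT eq_sym -bmeqP.
apply: (@no_higher_order_relation k F (fun i => translate s0 (f i)) E a0 (translate s0 (h a0))
   _ (fun a : 'X_{1..k < N.+1} => (a \in A) && (a0 < a :> 'X_{1..k})%O) (@bmnm k N.+1)
   (fun a => - translate s0 (h a))) => //.
- move=> i; rewrite mcoeff0_translate; move: s0S; rewrite inE => /forallP/(_ i).
  by move/eqP.
(* The value of [h a0] at [s0] is [c (a0, s0)], so its translate is a unit at the origin. *)
- rewrite mcoeff0_translate /h raddf_sum /= (bigD1 s0) //= mevalZ meval_indicator eqxx mulr1.
  rewrite big1 ?addr0 // => s /andP[_ ne_s].
  by rewrite mevalZ meval_indicator eq_sym (negPf ne_s) mulr0.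
- by move=> a /andP[].
have trans_prod a : mon_prod (fun i => translate s0 (f i)) a = translate s0 (mon_prod f a).
  rewrite /mon_prod rmorph_prod; apply: eq_bigr => i _.
  by rewrite rmorphXn.
under [RHS]eq_bigr do rewrite mulrN trans_prod.
rewrite sumrN trans_prod; apply/eqP; rewrite -addr_eq0; apply/eqP.
transitivity (translate s0 (\sum_(a in A) mon_prod f a * h a)); last first.
  by rewrite sum0 rmorph0.
rewrite [RHS]rmorph_sum /= [RHS](bigD1 a0) //= [X in _ = X + _]rmorphM; congr (_ + _).
rewrite [RHS](bigID (fun a : 'X_{1..k < N.+1} => (a0 < a :> 'X_{1..k})%O)) /=.
rewrite [X in _ = _ + X]big1 ?addr0 => [|a /andP[/andP[aA ne_a] nlt]]; last first.
  by rewrite h0 // mulr0 rmorph0.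
apply: eq_big => [a | a _]; last by rewrite rmorphM.
case: (a \in A) => //=; case: eqP => [->|//]; by rewrite ltxx.
Qed.

End Bezout.

Theorem theorem4p3 :
  (forall (k t : nat) (d : 'I_t -> nat),
     (1 <= t)%N -> (t <= k)%N -> (forall i, (0 < d i)%N) ->
     exists C : rat, 0 < C /\
       forall (F : finFieldType) (L : closedFieldType) (iota : {rmorphism F -> L}),
         algebraic_over iota ->
         prob (fun w : sample F k d =>
                 dim_gt (variety iota (polys w)) (k - t)%N)
           <= C * ((#|F|)%:R ^- dmin d))
  /\
  (forall (k : nat) (d : 'I_k -> nat),
     (1 <= k)%N -> (forall i, (0 < d i)%N) ->
     exists C : rat, 0 < C /\
       forall F : finFieldType,
         prob (fun w : sample F k d =>
                 (\prod_(i < k) d i < nb_rat_points (polys w))%N)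
           <= C * ((#|F|)%:R ^- dmin d)).
Proof.
split=> [k t d _ le_tk _ | k d k_gt0 d_gt0].
  (* The constant is built from [k] and [d] before any field is chosen; the successor makes it
     positive. *)
  exists (not_good_const k d).+1%:R; split=> [|F L iota _]; first by rewrite ltr0n.
  apply: (prob_le_not_good le_tk) => w dim_w good_w.
  exact: good_not_dim_gt (good_deg_gt0 _ _ _) good_w dim_w.
exists (not_good_const k d).+1%:R; split=> [|F]; first by rewrite ltr0n.
apply: (prob_le_not_good (leqnn k)) => w; rewrite ltnNge => /negP lt_w good_w.
apply: lt_w; apply: bezout k_gt0 d_gt0 _ good_w => i.
by apply: (@msize_supp_in _ _ setT); apply: supp_in_poly_of => m _ l; rewrite inE.
Qed.
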